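(* Let $r$ be a positive integer, $k\in\mathbb Z$, and $a_1,\dots,a_r$ nonzero complex numbers. Then for every integer $n\ge0$, \begin{align*} S_{n+1}^{(r,k)}(x|a_1,\dots,a_r)&=xS_n^{(r,k)}(x|a_1,\dots,a_r)-\frac{1}{n+1}\sum_{j=1}^r\sum_{l=0}^n\binom{n+1}{l}(-a_j)^{n+1-l}B_{n+1-l}S_l^{(r,k)}(x|a_1,\dots,a_r)\\ &\quad-\frac{1}{n+1}\left(S_{n+1}^{(r+1,k)}(x|a_1,\dots,a_r,1)-S_{n+1}^{(r+1,k-1)}(x|a_1,\dots,a_r,1)\right), \end{align*} where $B_m$ denotes the $m$th ordinary Bernoulli number.
   Context: For an integer $k$, ${\rm Li}_k(x)=\sum_{m=1}^\infty x^m/m^k$. For $r\in\mathbb Z_{>0}$, $k\in\mathbb Z$ and nonzero complex $a_1,\dots,a_r$, the polynomials $S_n^{(r,k)}(x|a_1,\dots,a_r)$ are defined by $\frac{t^r}{\prod_{j=1}^r(e^{a_jt}-1)}\frac{{\rm Li}_k(1-e^{-t})}{1-e^{-t}}e^{xt}=\sum_{n\ge0}S_n^{(r,k)}(x|a_1,\dots,a_r)\frac{t^n}{n!}$; thus $S_n^{(r+1,k')}(x|a_1,\dots,a_r,1)$ is the same with $r+1$ parameters, $a_{r+1}=1$ and $k'$ in place of $k$. Ordinary Bernoulli numbers: $\frac{t}{e^t-1}=\sum_{n\ge0}B_n\frac{t^n}{n!}$. *)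

(* Defs.v *)
From HB Require Import structures.
From mathcomp Require Import all_boot all_order all_algebra.
From mathcomp Require Import complex boolp reals.

Set Implicit Arguments.
Unset Strict Implicit.
Unset Printing Implicit Defensive.

Import GRing.Theory.
Local Open Scope ring_scope.

(* Formal power series; generating functions are read as elements of A[[t]].
   The record keeps the Cauchy product apart from the pointwise product that
   plain functions nat -> A carry. *)
Record fps (A : Type) := FPS { fps_coef : nat -> A }.
Coercion fps_coef : fps >-> Funclass.

HB.instance Definition _ (A : Type) := gen_eqMixin (fps A).
HB.instance Definition _ (A : Type) := gen_choiceMixin (fps A).

Lemma fpsP (A : Type) (f g : fps A) : f =1 g -> f = g.
Proof. by case: f g => [f] [g] /= /funext ->. Qed.

Section FpsRing.
Variable A : comNzRingType.
Implicit Types f g h : fps A.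

Definition fps_zero : fps A := FPS (fun=> 0).
Definition fps_one : fps A := FPS (fun n => (n == 0%N)%:R).
Definition fps_opp f : fps A := FPS (fun n => - f n).
Definition fps_add f g : fps A := FPS (fun n => f n + g n).
Definition fps_mul f g : fps A :=
  FPS (fun n => \sum_(i < n.+1) f i * g (n - i)%N).

Fact fps_addA : associative fps_add.
Proof. by move=> f g h; apply: fpsP => n /=; rewrite addrA. Qed.
Fact fps_addC : commutative fps_add.
Proof. by move=> f g; apply: fpsP => n /=; rewrite addrC. Qed.
Fact fps_add0 : left_id fps_zero fps_add.
Proof. by move=> f; apply: fpsP => n /=; rewrite add0r. Qed.
Fact fps_addN : left_inverse fps_zero fps_opp fps_add.
Proof. by move=> f; apply: fpsP => n /=; rewrite addNr. Qed.

HB.instance Definition _ :=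
  GRing.isZmodule.Build (fps A) fps_addA fps_addC fps_add0 fps_addN.

Fact fps_mul_rev f g n :
  fps_mul f g n = \sum_(i < n.+1) f (n - i)%N * g i.
Proof.
rewrite /= (reindex_inj rev_ord_inj) /=.
by apply: eq_bigr => i _; rewrite subSS (sub_ordK i).
Qed.

Fact fps_mulC : commutative fps_mul.
Proof.
move=> f g; apply: fpsP => n; rewrite fps_mul_rev /=.
by apply: eq_bigr => i _; rewrite mulrC.
Qed.

Fact fps_mulA : associative fps_mul.
Proof.
move=> p q s; apply: fpsP => i; rewrite [RHS]fps_mul_rev.
pose coef3 j k := p j * (q (i - j - k)%N * s k).
transitivity (\sum_(j < i.+1) \sum_(k < i.+1 | (k <= i - j)%N) coef3 j k).
  apply: eq_bigr => j _; rewrite fps_mul_rev big_distrr /=.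
  by rewrite (big_ord_narrow_leq (leq_subr _ _)).
rewrite (exchange_big_dep predT) //=; apply: eq_bigr => k _.
transitivity (\sum_(j < i.+1 | (j <= i - k)%N) coef3 j k).
  apply: eq_bigl => j; rewrite -ltnS -(ltnS j) -!subSn ?leq_ord //.
  by rewrite -subn_gt0 -(subn_gt0 j) -!subnDA addnC.
rewrite (big_ord_narrow_leq (leq_subr _ _)) big_distrl /=.
by apply: eq_bigr => i0 _; rewrite /coef3 -!subnDA addnC mulrA.
Qed.

Fact fps_mul1 : left_id fps_one fps_mul.
Proof.
move=> f; apply: fpsP => n /=; rewrite big_ord_recl /= subn0 mul1r.
by rewrite big1 ?addr0 // => i _; rewrite mul0r.
Qed.

Fact fps_mulDl : left_distributive fps_mul fps_add.
Proof.
move=> f g h; apply: fpsP => n /=; rewrite -big_split /=.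
by apply: eq_bigr => i _; rewrite mulrDl.
Qed.

Fact fps_oner_neq0 : fps_one != 0.
Proof.
apply/eqP => /(congr1 (fun f : fps A => f 0%N)) /= /eqP.
by rewrite oner_eq0.
Qed.

HB.instance Definition _ := GRing.Zmodule_isComNzRing.Build (fps A)
  fps_mulA fps_mulC fps_mul1 fps_mulDl fps_oner_neq0.

Definition fps_const (c : A) : fps A := FPS (fun n => if n is 0 then c else 0).
Definition fps_X : fps A := FPS (fun n => (n == 1%N)%:R).

(* f(g(t)) for a series g without constant term: g ^+ m then has no
   coefficient below degree m, so the sum over m may stop at n. *)
Definition fps_comp f g : fps A := FPS (fun n => \sum_(m < n.+1) f m * (g ^+ m) n).

Definition fps_shift (d : nat) f : fps A := FPS (fun n => f (n + d)%N).

(* The lowest degree of a nonzero coefficient; 0 by convention if f = 0. *)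
Definition fps_order f : nat :=
  if pselect (exists n, f n != 0) is left ex_f then ex_minn ex_f else 0%N.

End FpsRing.

Arguments fps_X {A}.

Section FpsUnit.
Variable A : comUnitRingType.
Implicit Types f g : fps A.

Definition fps_unit : pred (fps A) := fun f => f 0%N \is a GRing.unit.

(* With f(t) = c (1 - h(t)), c = f(0), this is c^-1 * \sum_m h(t)^m. *)
Definition fps_inv f : fps A :=
  if fps_unit f then
    let c' := fps_const (f 0%N)^-1 in c' * fps_comp (FPS (fun=> 1)) (1 - c' * f)
  else f.

Lemma fpsME f g n : (f * g) n = \sum_(i < n.+1) f i * g (n - i)%N.
Proof. by []. Qed.

Lemma fpsDE f g n : (f + g) n = f n + g n. Proof. by []. Qed.
Lemma fpsNE f n : (- f) n = - f n. Proof. by []. Qed.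
Lemma fps1E n : (1 : fps A) n = (n == 0%N)%:R. Proof. by []. Qed.

Lemma fpsM0E f g : (f * g) 0%N = f 0%N * g 0%N.
Proof. by rewrite fpsME big_ord1. Qed.

Lemma fps_sumE (I : Type) (s : seq I) (P : pred I) (F : I -> fps A) n :
  (\sum_(i <- s | P i) F i) n = \sum_(i <- s | P i) F i n.
Proof. exact: (big_morph (fun f : fps A => f n) (fun f g => erefl) erefl). Qed.

Lemma fps_constM c f n : (fps_const c * f) n = c * f n.
Proof.
rewrite fpsME big_ord_recl /= subn0 big1 ?addr0 // => i _.
by rewrite mul0r.
Qed.

Lemma fps_exp_small f m n : f 0%N = 0 -> (n < m)%N -> (f ^+ m) n = 0.
Proof.
move=> f0; elim: m n => // m IH n lenm; rewrite exprS fpsME big1 // => i _.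
case: (posnP i) => [-> |i_gt0]; first by rewrite f0 mul0r.
rewrite IH ?mulr0 //; move: (ltn_ord i) lenm; rewrite !ltnS => lein lenm.
by rewrite (leq_trans _ lenm) // ltn_subrL i_gt0 (leq_trans i_gt0 lein).
Qed.

Fact fps_mulVr : {in fps_unit, left_inverse 1 fps_inv *%R}.
Proof.
move=> f uf; rewrite /fps_inv [fps_unit f]uf /=.
set c' := fps_const _; set h := 1 - c' * f.
have h0 : h 0%N = 0.
  by rewrite /h fpsDE fpsNE fps1E fps_constM mulVr // subrr.
rewrite mulrAC.
have -> : c' * f = 1 - h by rewrite /h opprB addrCA subrr addr0.
move: h h0 => h h0; apply: fpsP => n.
transitivity (((1 - h) * \sum_(m < n.+1) h ^+ m) n).
  rewrite !fpsME; apply: eq_bigr => i _; congr (_ * _).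
  rewrite fps_sumE /= (big_ord_widen n.+1 (fun m => 1 * (h ^+ m) (n - i)%N)).
    rewrite big_mkcond /=; apply: eq_bigr => m _; rewrite mul1r.
    by case: ltnP => // ltm; rewrite fps_exp_small.
  by rewrite ltnS leq_subr.
have -> : (1 - h) * \sum_(m < n.+1) h ^+ m = 1 - h ^+ n.+1.
  by rewrite -[RHS]opprB subrX1 -mulNr opprB.
by rewrite fpsDE fpsNE fps_exp_small // subr0.
Qed.

Fact fps_unitPl f g : g * f = 1 -> fps_unit f.
Proof.
move=> gf1; apply/unitrPr; exists (g 0%N).
by rewrite mulrC -fpsM0E gf1.
Qed.

Fact fps_inv_out : {in [predC fps_unit], fps_inv =1 id}.
Proof. by move=> f /negPf nuf; rewrite /fps_inv [fps_unit f]nuf. Qed.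

HB.instance Definition _ := GRing.ComNzRing_hasMulInverse.Build (fps A)
  fps_mulVr fps_unitPl fps_inv_out.

(* The quotient f / g as a power series, for a divisor g of order d >= 0:
   a common factor t^d is cancelled first. See fps_divK below. *)
Definition fps_div f g : fps A :=
  let d := fps_order g in fps_shift d f / fps_shift d g.

Definition fps_exp (c : A) : fps A := FPS (fun n => c ^+ n / n`!%:R).

Definition fps_polylog (k : int) : fps A :=
  FPS (fun m => if m is 0 then 0 else (m%:R ^ k)^-1).

Definition egf_coef f (n : nat) : A := f n *+ n`!.

Lemma fps_orderP g d : g d != 0 -> (forall n, (n < d)%N -> g n = 0) ->
  fps_order g = d.
Proof.
move=> gd gn; rewrite /fps_order; case: pselect => [ex|[]]; last by exists d.
case: ex_minnP => m gm minm; apply/eqP; rewrite eqn_leq minm //= leqNgt.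
by apply/negP => /gn gm0; rewrite gm0 eqxx in gm.
Qed.

Lemma fps_shiftK d f : (forall n, (n < d)%N -> f n = 0) ->
  fps_X ^+ d * fps_shift d f = f.
Proof.
have XnE n : (fps_X ^+ d : fps A) n = (n == d)%:R.
  elim: d n => // d IH [|n]; rewrite exprS fpsME.
    by rewrite big_ord1 /= mul0r.
  rewrite big_ord_recl /= mul0r add0r big_ord_recl /= mul1r.
  rewrite subSS subn0 IH eqSS big1 ?addr0 // => i _.
  by rewrite mul0r.
move=> f0; apply: fpsP => n; rewrite fpsME.
case: (ltnP n d) => [ltnd|ledn].
  rewrite f0 // big1 // => i _; rewrite XnE.
  by rewrite (ltn_eqF (leq_ltn_trans _ ltnd)) ?mul0r // -ltnS.
have ltd : (d < n.+1)%N by rewrite ltnS.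
rewrite (bigD1 (Ordinal ltd)) //= XnE eqxx mul1r subnK // big1 ?addr0 // => i.
by rewrite -val_eqE XnE /= => /negPf ->; rewrite mul0r.
Qed.

Lemma fps_divK f g d : g d \is a GRing.unit ->
  (forall n, (n < d)%N -> g n = 0) -> (forall n, (n < d)%N -> f n = 0) ->
  fps_div f g * g = f.
Proof.
move=> ug g0 f0.
have gd : g d != 0 by apply: contraTneq ug => ->; rewrite unitr0.
rewrite /fps_div (fps_orderP gd g0) -[X in _ * X](fps_shiftK g0).
by rewrite mulrCA divrK ?fps_shiftK.
Qed.

End FpsUnit.

(* Ordinary Bernoulli numbers: t / (e^t - 1) = \sum_n B_n t^n / n!. *)
Definition bernoulli (F : fieldType) : nat -> F :=
  egf_coef (fps_div fps_X (fps_exp 1 - 1)).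

(* The generating function is a power series in t over the ring {poly F} of
   polynomials in x = 'X, so that the S_n are genuine polynomials in x. *)
Definition S_gf (F : fieldType) (r : nat) (k : int) (a : r.-tuple F) :
    fps {poly F} :=
  fps_div (fps_X ^+ r) (\prod_(j < r) (fps_exp (tnth a j)%:P - 1))
  * fps_div (fps_comp (fps_polylog {poly F} k) (1 - fps_exp (-1)))
            (1 - fps_exp (-1))
  * fps_exp 'X.

Definition S_poly (F : fieldType) (r : nat) (k : int) (a : r.-tuple F)
    (n : nat) : {poly F} :=
  egf_coef (S_gf k a) n.

Lemma fps_XnE (A : comUnitRingType) d (f : fps A) n :
  (fps_X ^+ d * f) n = if (n < d)%N then 0 else f (n - d)%N.
Proof.
elim: d n => [|d IH] [|n]; rewrite ?mul1r ?subn0 // exprS -mulrA fpsME.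
  by rewrite big_ord1 /= mul0r.
have X0 i : (i != 1)%N -> (fps_X : fps A) i = 0 by case: i => [|[]].
rewrite (bigD1 (Ordinal (isT : 1 < n.+2)%N)) // [fps_X _]/= mul1r.
rewrite (_ : n.+1 - _ = n)%N ?subSS ?subn0 // IH ltnS big1 ?[LHS]addr0 // => i.
by rewrite -val_eqE => /X0 ->; rewrite mul0r.
Qed.

Lemma fps_exp_sub1 (A : comUnitRingType) (c : A) :
  fps_exp c - 1 = fps_X * fps_shift 1 (fps_exp c).
Proof.
rewrite -[in RHS](expr1 fps_X); apply: fpsP => -[|n]; rewrite fps_XnE /=.
  by rewrite divr1 expr0 subrr.
by rewrite subSS subn0 addn1 subr0.
Qed.

(* The quotients in S_gf and bernoulli are exact: multiplied by their
   denominators they give back their numerators. *)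
Lemma S_gfK (F : fieldType) r (k : int) (a : r.-tuple F) :
  (forall j, tnth a j != 0) ->
  S_gf k a * (\prod_(j < r) (fps_exp (tnth a j)%:P - 1) * (1 - fps_exp (-1)))
  = fps_X ^+ r * fps_comp (fps_polylog {poly F} k) (1 - fps_exp (-1))
    * fps_exp 'X.
Proof.
move=> a0; rewrite /S_gf mulrAC; congr (_ * _); rewrite mulrACA.
congr (_ * _).
  have PE : \prod_(j < r) (fps_exp (tnth a j)%:P - 1) =
     fps_X ^+ r * \prod_(j < r) fps_shift 1 (fps_exp (tnth a j)%:P).
    under eq_bigr do rewrite fps_exp_sub1.
    by rewrite big_split /= prodr_const card_ord.
  apply: (@fps_divK _ _ _ r); rewrite ?PE.
  - rewrite fps_XnE ltnn subnn.
    rewrite (big_morph (fun f : fps {poly F} => f 0%N) (fun f g => fpsM0E f g) erefl).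
    rewrite rpred_prod // => j _ /=.
    by rewrite add0n expr1 divr1 rmorph_unit //= unitfE.
  - by move=> n ltn; rewrite fps_XnE ltn.
  - by move=> n ltn; rewrite -[fps_X ^+ r]mulr1 fps_XnE ltn.
apply: (@fps_divK _ _ _ 1).
- by rewrite /= sub0r expr1 divr1 opprK unitr1.
- by case=> // _; rewrite /= expr0 divr1 subrr.
- by case=> // _; rewrite /= big_ord1 /= mul0r.
Qed.

Lemma bernoulliK (F : fieldType) :
  fps_div fps_X (fps_exp 1 - 1) * (fps_exp 1 - 1) = fps_X :> fps F.
Proof.
apply: (@fps_divK _ _ _ 1).
- by rewrite /= subr0 expr1 divr1 unitr1.
- by case=> // _; rewrite /= expr0 divr1 subrr.
- by case.
Qed.

(* Main.v *)
Require Import Defs.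
From mathcomp Require Import all_boot all_order all_algebra.
From mathcomp Require Import complex reals.
From mathcomp Require Import ring.

Set Implicit Arguments.
Unset Strict Implicit.
Unset Printing Implicit Defensive.

Import GRing.Theory.
Local Open Scope ring_scope.

(** Apply the Euler operator [t d/dt], which is a derivation, to the generating
    function [G]. Writing [e^(ct) - 1 = t U_c], each factor [1 / U_c]
    contributes [1 - c e^(ct) / U_c], and [c e^(ct) / U_c] is the Bernoulli
    series evaluated at [- c t]. Since [t d/dt Li_k = Li_(k-1)], the factor
    [H_k = Li_k(1 - e^(-t)) / (1 - e^(-t))] contributes
    [(H_(k-1) - H_k) / U_1], the division by [U_1] being the extra parameter
    [1]. Comparing coefficients of [t^(n+1)] gives the recurrence. *)

Section EulerOperator.
Variable A : comUnitRingType.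
Implicit Types f g : fps A.

(** * The Euler operator as a derivation *)

Definition fps_euler f : fps A := FPS (fun n => f n *+ n).

Lemma fps_eulerD f g : fps_euler (f + g) = fps_euler f + fps_euler g.
Proof. by apply: fpsP => n /=; rewrite mulrnDl. Qed.

Lemma fps_eulerN f : fps_euler (- f) = - fps_euler f.
Proof. by apply: fpsP => n /=; rewrite mulNrn. Qed.

Lemma fps_euler0 : fps_euler 0 = 0.
Proof. by apply: fpsP => n /=; rewrite mul0rn. Qed.

Lemma fps_constMn c m : fps_const (c *+ m) = fps_const c *+ m :> fps A.
Proof.
elim: m => [|m IH]; first by apply: fpsP => -[].
by rewrite !mulrS -IH; apply: fpsP => -[|i] //=; rewrite addr0.
Qed.

Lemma fps_euler_const c : fps_euler (fps_const c) = 0.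
Proof. by apply: fpsP => -[|n] //=; rewrite mul0rn. Qed.

Lemma fps_euler1 : fps_euler 1 = 0.
Proof. by apply: fpsP => -[|n] //=; rewrite mul0rn. Qed.

Lemma fps_eulerX : fps_euler fps_X = fps_X.
Proof. by apply: fpsP => -[|[|n]] //=; rewrite mul0rn. Qed.

(** In each term of the Cauchy product the weight splits as [n = i + (n - i)]. *)
Lemma fps_eulerM f g :
  fps_euler (f * g) = fps_euler f * g + f * fps_euler g.
Proof.
apply: fpsP => n; rewrite fpsDE !fpsME /= -sumrMnl -big_split /=.
apply: eq_bigr => i _.
by rewrite mulrnAl mulrnAr -mulrnDr subnKC // -ltnS.
Qed.

Lemma fps_euler_exp f m :
  fps_euler (f ^+ m.+1) = f ^+ m * fps_euler f *+ m.+1.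
Proof.
elim: m => [|m IH]; first by rewrite expr1 mul1r.
by rewrite exprS fps_eulerM IH mulrnAr mulrA -exprS [in RHS]mulrS [_ * f ^+ _]mulrC.
Qed.

Lemma fps_euler_sum (I : Type) (s : seq I) (P : pred I) (F : I -> fps A) :
  fps_euler (\sum_(i <- s | P i) F i) = \sum_(i <- s | P i) fps_euler (F i).
Proof. exact: (big_morph _ fps_eulerD fps_euler0). Qed.

Lemma fps_eulerV f : f \is a GRing.unit ->
  fps_euler f^-1 = - (fps_euler f / f) / f.
Proof.
move=> uf; apply: (mulIr uf); rewrite divrK //.
apply/eqP; rewrite -addr_eq0 [_ / f]mulrC -fps_eulerM mulVr //.
by rewrite fps_euler1.
Qed.

(** The series [t] is not a unit; it is cancelled by comparing coefficients one degree up. *)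
Lemma fps_Xreg f g : fps_X * f = fps_X * g -> f = g.
Proof.
rewrite -[fps_X]expr1 => fg; apply: fpsP => n.
have := congr1 (fun h : fps A => h n.+1) fg.
by rewrite !fps_XnE /= subSS subn0.
Qed.

Lemma fps_Xnreg d f g : fps_X ^+ d * f = fps_X ^+ d * g -> f = g.
Proof.
by elim: d f g => [|d IH] f g; rewrite ?mul1r // exprS -!mulrA => /fps_Xreg /IH.
Qed.

(** * Composition of series and the chain rule *)

Lemma fps_mul_coef_eq f f' g g' n :
    (forall i, (i <= n)%N -> f i = f' i) ->
    (forall i, (i <= n)%N -> g i = g' i) ->
  (f * g) n = (f' * g') n.
Proof.
move=> ff gg; rewrite !fpsME; apply: eq_bigr => i _.
by rewrite ff ?gg ?leq_subr // -ltnS.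
Qed.

(** [fps_comp] cuts its sum separately at each coefficient. With one common bound the composite
    becomes a finite sum of series, to which the rules for a derivation apply. *)
Definition fps_comp_trunc f g N := \sum_(m < N) fps_const (f m) * g ^+ m.

Lemma fps_comp_truncE f g N n : g 0%N = 0 -> (n < N)%N ->
  fps_comp f g n = fps_comp_trunc f g N n.
Proof.
move=> g0 nN; rewrite /fps_comp_trunc fps_sumE [LHS]/=.
rewrite (big_ord_widen N (fun m => f m * (g ^+ m) n)) // big_mkcond.
apply: eq_bigr => m _; rewrite fps_constM.
by case: ltnP => // ltm; rewrite fps_exp_small ?mulr0.
Qed.

(* The chain rule multiplied by [g], so that only Euler operators occur. *)
Lemma fps_euler_comp f g : g 0%N = 0 ->
  fps_euler (fps_comp f g) * g = fps_comp (fps_euler f) g * fps_euler g.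
Proof.
move=> g0; apply: fpsP => n.
(* Coefficient [n] of a product sees only the coefficients up to [n] of its factors, so both
   composites may be cut at [n.+1]. *)
transitivity ((fps_euler (fps_comp_trunc f g n.+1) * g) n).
  by apply: fps_mul_coef_eq => i lein //=; rewrite -fps_comp_truncE.
transitivity ((fps_comp_trunc (fps_euler f) g n.+1 * fps_euler g) n); last first.
  by apply: fps_mul_coef_eq => i lein //; rewrite -fps_comp_truncE.
congr (fps_coef _ n).
rewrite /fps_comp_trunc fps_euler_sum !big_distrl /=; apply: eq_bigr => -[[|m] _] _ /=.
  (* For [m = 0] both sides vanish: a constant on the left, a coefficient weighted by 0 on the
     right. *)
  rewrite mulr1 fps_euler_const mul0r mulr0n.
  suff -> : fps_const 0 = 0 :> fps A by rewrite !mul0r.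
  by apply: fpsP => -[].
rewrite fps_eulerM fps_euler_const mul0r add0r fps_euler_exp.
rewrite fps_constMn mulrnAr !mulrnAl; congr (_ *+ _).
by rewrite exprSr; ring.
Qed.

(** * Exponentials and polylogarithms, with positive integers invertible *)

Hypothesis natU : forall n, n.+1%:R \is a @GRing.unit A.

Lemma factU n : n`!%:R \is a @GRing.unit A.
Proof. by have := fact_gt0 n; case: n`! => // m _; apply: natU. Qed.

Lemma fps_euler_eq0 f : fps_euler f = 0 -> f = fps_const (f 0%N).
Proof.
move=> f0; apply: fpsP => -[|n] //=.
have := congr1 (fun h : fps A => h n.+1) f0; rewrite /= -mulr_natr => fn.
by apply: (mulIr (natU n)); rewrite mul0r fn.
Qed.

Lemma fps_euler_fps_exp (c : A) :
  fps_euler (fps_exp c) = fps_const c * fps_X * fps_exp c.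
Proof.
apply: fpsP => n; rewrite -mulrA fps_constM -[fps_X]expr1 fps_XnE.
case: n => [|n] /=; first by rewrite mulr0.
rewrite subSS subn0 exprS factS natrM invrM ?factU //.
by rewrite -[LHS]mulr_natr -!mulrA mulVr ?mulr1.
Qed.

(** The Euler operator kills the product, so it equals its constant term. *)
Lemma fps_expN (c : A) : fps_exp c * fps_exp (- c) = 1.
Proof.
rewrite (@fps_euler_eq0 (fps_exp c * fps_exp (- c))).
  by rewrite fpsM0E /= !expr0 divr1 mulr1; apply: fpsP => -[].
rewrite fps_eulerM !fps_euler_fps_exp.
have -> : fps_const (- c) = - fps_const c.
  by apply: fpsP => -[|n] //=; rewrite oppr0.
by ring.
Qed.

(* [(e^(ct) - 1) / t] *)
Definition fps_expq (c : A) : fps A := fps_shift 1 (fps_exp c).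

Lemma fps_expq_unit (c : A) :
  c \is a GRing.unit -> fps_expq c \is a GRing.unit.
Proof.
move=> uc; suff : fps_expq c 0%N \is a GRing.unit by [].
by rewrite /= expr1 divr1.
Qed.

(** Apply the Euler operator to [e^(ct) - 1 = t U_c] and cancel [t]. *)
Lemma fps_euler_expq (c : A) :
  fps_euler (fps_expq c) = fps_const c * fps_exp c - fps_expq c.
Proof.
apply: fps_Xreg; have := congr1 fps_euler (fps_exp_sub1 c).
rewrite fps_eulerD fps_eulerN fps_euler1 fps_euler_fps_exp oppr0 addr0.
rewrite fps_eulerM fps_eulerX -/(fps_expq c) => e.
by rewrite mulrBr mulrA [fps_X * fps_const c]mulrC e; ring.
Qed.

Lemma fps_euler_expqV (c : A) : c \is a GRing.unit ->
  fps_euler (fps_expq c)^-1 =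
    (fps_expq c)^-1 * (1 - fps_const c * fps_exp c / fps_expq c).
Proof.
move=> uc; have uU := fps_expq_unit uc.
by rewrite fps_eulerV // fps_euler_expq mulrBl divrr //; ring.
Qed.

Lemma fps_1subexpN (c : A) : 1 - fps_exp (- c) = fps_X * (fps_expq c * fps_exp (- c)).
Proof. by rewrite mulrA -fps_exp_sub1 mulrBl fps_expN mul1r. Qed.

Lemma fps_euler_polylog k :
  fps_euler (fps_polylog A k) = fps_polylog A (k - 1).
Proof.
apply: fpsP => -[|n] //=.
rewrite exprzDr ?natU // exprN1 invrM ?unitrV // ?invrK ?mulr_natl //.
by case: k => m; rewrite ?unitrV unitrX.
Qed.

Definition polylog_quot (k : int) : fps A :=
  fps_div (fps_comp (fps_polylog A k) (1 - fps_exp (-1))) (1 - fps_exp (-1)).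

Lemma polylog_quotK k : polylog_quot k * (1 - fps_exp (-1)) =
  fps_comp (fps_polylog A k) (1 - fps_exp (-1)).
Proof.
apply: (@fps_divK _ _ _ 1).
- by rewrite /= sub0r expr1 divr1 opprK unitr1.
- by case=> // _; rewrite /= expr0 divr1 subrr.
- by case=> // _; rewrite /= big_ord1 /= mul0r.
Qed.

(** Put [E = 1 - e^(-t)] and write [D] for the Euler operator. The chain rule for [Li_k(E) = H_k E]
    gives [D(H_k) E = (H_(k-1) - H_k) D(E)], and [D(E) / E = 1 / U_1] since [D(E) = t e^(-t)] and
    [E = t U_1 e^(-t)]. *)
Lemma fps_euler_polylog_quot k :
  fps_euler (polylog_quot k) =
    (polylog_quot (k - 1) - polylog_quot k) / fps_expq 1.
Proof.
have uU : fps_expq 1 \is a GRing.unit by rewrite fps_expq_unit ?unitr1.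
have ue : fps_exp (-1) \is a @GRing.unit (fps A).
  by apply/unitrPr; exists (fps_exp 1); rewrite mulrC fps_expN.
apply: (mulIr uU); rewrite divrK //.
pose E : fps A := 1 - fps_exp (-1).
have E0 : E 0%N = 0 by rewrite /= expr0 divr1 subrr.
have dE : fps_euler E = fps_X * fps_exp (-1).
  rewrite fps_eulerD fps_eulerN fps_euler1 fps_euler_fps_exp.
  have -> : fps_const (-1) = -1 :> fps A.
    by apply: fpsP => -[|n] //=; rewrite oppr0.
  by ring.
have := fps_euler_comp (fps_polylog A k) E0.
rewrite fps_euler_polylog -!polylog_quotK fps_eulerM -/E dE.
rewrite /E fps_1subexpN => e.
(* The relation [e] is the goal multiplied by [t^2 U_1 e^(-2t)]. *)
apply: (mulIr ue); apply: (mulIr uU); apply: (mulIr ue).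
apply: (@fps_Xnreg 2).
apply/eqP; rewrite -subr_eq0; move/eqP: e; rewrite -subr_eq0 => /eqP e.
by rewrite -[X in _ == X]e; apply/eqP; ring.
Qed.

End EulerOperator.

(** * The Bernoulli series and the factors [1 / U_c] *)

Section Recurrence.
Variable F : fieldType.
Hypothesis natF : forall n, n.+1%:R != 0 :> F.

Lemma poly_natU n : n.+1%:R \is a @GRing.unit {poly F}.
Proof. by rewrite -(rmorph_nat polyC) rmorph_unit // unitfE. Qed.

(* [f(s t)], with coefficients read as constant polynomials. *)
Definition fps_scale (s : F) (f : fps F) : fps {poly F} :=
  FPS (fun n => (s ^+ n * f n)%:P).

Lemma fps_scaleE s f n : fps_scale s f n = (s ^+ n * f n)%:P.
Proof. by []. Qed.

Lemma fps_scaleM s f g : fps_scale s (f * g) = fps_scale s f * fps_scale s g.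
Proof.
apply: fpsP => n; rewrite fpsME /= mulr_sumr rmorph_sum /=.
apply: eq_bigr => i _; rewrite -polyCM; congr polyC.
by rewrite mulrACA -exprD subnKC // -ltnS.
Qed.

Lemma fps_scale1 s : fps_scale s 1 = 1.
Proof. by apply: fpsP => -[|n]; rewrite /= ?mulr1 ?mulr0. Qed.

Lemma fps_exp_scale s : fps_scale s (fps_exp 1) = fps_exp s%:P.
Proof.
apply: fpsP => n /=; rewrite expr1n mul1r rmorphM rmorphXn /=.
by rewrite rmorphV ?unitfE ?rmorph_nat // -unitfE factU // => m; rewrite unitfE.
Qed.

Definition bernoulli_gf : fps F := fps_div fps_X (fps_exp 1 - 1).

Lemma bernoulli_gfK : bernoulli_gf * fps_expq (1 : F) = 1.
Proof.
apply: fps_Xreg; rewrite mulr1 -[RHS](bernoulliK F) -/bernoulli_gf [in RHS]fps_exp_sub1.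
by rewrite mulrCA.
Qed.

Lemma bernoulli_gf_scaleN c :
  fps_scale (- c) bernoulli_gf * fps_expq c%:P =
    fps_const c%:P * fps_exp c%:P.
Proof.
(* Since [e^(ct) - 1 = e^(ct) (1 - e^(-ct))], one has [U_c(t) = c e^(ct) U_1(-ct)]; the Bernoulli
   series at [-ct] is inverse to [U_1(-ct)]. *)
suff -> : fps_expq c%:P =
    fps_const c%:P * fps_exp c%:P * fps_scale (- c) (fps_expq (1 : F)).
  rewrite mulrCA -fps_scaleM.
  by rewrite bernoulli_gfK fps_scale1 mulr1.
apply: fps_Xreg; rewrite -fps_exp_sub1.
have sX : fps_scale (- c) fps_X = - fps_const c%:P * fps_X.
  apply: fpsP => n; rewrite mulNr fpsNE fps_constM.
  by case: n => [|[|n]]; rewrite /= ?mulr0 ?mulr1 ?oppr0 // polyCN.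
have := congr1 (fps_scale (- c)) (fps_exp_sub1 (1 : F)).
rewrite fps_scaleM sX.
have -> : fps_scale (- c) (fps_exp 1 - 1) = fps_exp (- c%:P) - 1.
  rewrite -polyCN -fps_exp_scale -(fps_scale1 (- c)).
  by apply: fpsP => n /=; rewrite mulrBr polyCB.
move=> e; rewrite -(fps_expN poly_natU c%:P).
rewrite -[X in X - _]mulr1 -mulrBr -opprB e /fps_expq.
by ring.
Qed.

(** Once [t^r] is cancelled the denominator is a unit. A product over the list lets an appended
    parameter [1] show up as one more factor [1 / U_1]. *)
Lemma S_gf_quot (r : nat) (a : r.-tuple F) : (forall j, tnth a j != 0) ->
  fps_div (fps_X ^+ r) (\prod_(j < r) (fps_exp (tnth a j)%:P - 1)) =
    \prod_(c <- a) (fps_expq c%:P)^-1.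
Proof.
move=> a0; set P := \prod_(j < r) _.
pose U := \prod_(c <- a) fps_expq c%:P.
have PE : P = fps_X ^+ r * U.
  rewrite /P /U big_tuple; under eq_bigr do rewrite fps_exp_sub1.
  by rewrite big_split /= prodr_const card_ord.
have aU j : (tnth a j)%:P \is a @GRing.unit {poly F}.
  by rewrite rmorph_unit ?unitfE.
have UV : U * \prod_(c <- a) (fps_expq c%:P)^-1 = 1.
  rewrite -big_split big_tuple big1 //= => j _.
  by rewrite divrr // fps_expq_unit.
have uU : U \is a GRing.unit by apply/unitrPr; eexists; apply: UV.
have : fps_div (fps_X ^+ r) P * P = fps_X ^+ r.
  apply: (@fps_divK _ _ _ r); rewrite ?PE.
  - by rewrite fps_XnE ltnn subnn.
  - by move=> n ltn; rewrite fps_XnE ltn.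
  - by move=> n ltn; rewrite -[fps_X ^+ r]mulr1 fps_XnE ltn.
rewrite {2}PE mulrCA -[RHS]mulr1 => /fps_Xnreg e.
by apply: (mulIr uU); rewrite e mulrC UV.
Qed.

Lemma S_gfE (r : nat) (k : int) (a : r.-tuple F) : (forall j, tnth a j != 0) ->
  S_gf k a = \prod_(c <- a) (fps_expq c%:P)^-1
             * polylog_quot {poly F} k * fps_exp 'X.
Proof. by move=> a0; rewrite /S_gf S_gf_quot. Qed.

(** Logarithmic derivatives add up over the factors. *)
Lemma fps_euler_prod_expqV (s : seq F) : {in s, forall c, c != 0} ->
  fps_euler (\prod_(c <- s) (fps_expq c%:P)^-1) =
    \prod_(c <- s) (fps_expq c%:P)^-1
    * \sum_(c <- s) (1 - fps_scale (- c) bernoulli_gf).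
Proof.
elim: s => [|c s IH] s0; first by rewrite !big_nil fps_euler1 mulr0.
have c0 : c%:P \is a @GRing.unit {poly F}.
  by rewrite rmorph_unit ?unitfE ?s0 ?mem_head.
rewrite !big_cons fps_eulerM IH => [|d ds]; last by rewrite s0 // in_cons ds orbT.
rewrite (fps_euler_expqV poly_natU) // -bernoulli_gf_scaleN.
by rewrite mulrK ?fps_expq_unit //; ring.
Qed.

(** * The equation for the generating function and its coefficients *)

Lemma fps_euler_S_gf (r : nat) (k : int) (a : r.-tuple F) :
    (forall j, tnth a j != 0) ->
  fps_euler (S_gf k a) =
    fps_const 'X * (fps_X * S_gf k a)
    + (\sum_(j < r) (1 - fps_scale (- tnth a j) bernoulli_gf)) * S_gf k a
    - (S_gf k (rcons_tuple a 1) - S_gf (k - 1) (rcons_tuple a 1)).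
Proof.
move=> a0.
have a1 j : tnth (rcons_tuple a 1) j != 0.
  have := mem_tnth j (rcons_tuple a 1); rewrite mem_rcons in_cons.
  by case/orP => [/eqP ->|/tnthP[i ->]] //; rewrite oner_neq0.
rewrite !S_gfE // 2!fps_eulerM (fps_euler_fps_exp poly_natU).
rewrite (fps_euler_polylog_quot poly_natU).
rewrite fps_euler_prod_expqV => [|c /tnthP[i ->]] //.
rewrite [\sum_(c <- a) _]big_tuple /= !big_rcons /=.
by ring.
Qed.

(** As [B_0 = 1], the factor [1 - B(-ct)] has no constant term, so the sum stops at [l = n];
    binomials come from [(n+1)! = C(n+1, l) l! (n+1-l)!]. *)
Lemma coef_bernoulli_factor (c : F) (f : fps {poly F}) n :
  ((1 - fps_scale (- c) bernoulli_gf) * f) n.+1 *+ n.+1`! =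
    - \sum_(l < n.+1) ('C(n.+1, l)%:R * (- c) ^+ (n.+1 - l)
                       * bernoulli F (n.+1 - l)) *: egf_coef f l.
Proof.
have b0 : bernoulli_gf 0%N = 1.
  have := congr1 (fun g : fps F => g 0%N) bernoulli_gfK.
  by rewrite fpsM0E /= expr1 divr1 mulr1.
rewrite [_ * f]mulrC fpsME big_ord_recr subnn fpsDE fpsNE fps_scaleE b0.
rewrite mulr1 subrr mulr0 [X in X *+ _]addr0.
rewrite -sumrMnl -sumrN; apply: eq_bigr => l _.
have lt_ln : (l < n.+1)%N by [].
rewrite -(bin_fact (ltnW lt_ln)) /bernoulli /egf_coef -/bernoulli_gf.
have := lt_ln; rewrite -subn_gt0; case: (n.+1 - l)%N => // m _.
rewrite fpsDE fpsNE fps_scaleE sub0r mulrN mulNrn; congr (- _).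
rewrite -[LHS]mulr_natr 2!natrM -[bernoulli_gf _ *+ _]mulr_natr.
rewrite -[fps_coef f l *+ _]mulr_natr -mul_polyC !polyCM !polyC_natr.
rewrite -[fps_coef f (widen_ord _ _)]/(fps_coef f l).
move: (m.+1`!) => q.
by ring.
Qed.

Lemma S_poly_recurrence (r : nat) (k : int) (a : r.-tuple F) (n : nat) :
    (forall j, tnth a j != 0) ->
  S_poly k a n.+1 =
    'X * S_poly k a n
    - (n.+1%:R)^-1 *: (\sum_(j < r) \sum_(l < n.+1)
        ('C(n.+1, l)%:R * (- tnth a j) ^+ (n.+1 - l)
          * bernoulli F (n.+1 - l)) *: S_poly k a l)
    - (n.+1%:R)^-1 *: (S_poly k (rcons_tuple a 1) n.+1
                       - S_poly (k - 1) (rcons_tuple a 1) n.+1).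
Proof.
move=> a0; have := fps_euler_S_gf k a0; rewrite /S_poly.
move: (S_gf k a) (S_gf k (rcons_tuple a 1)) (S_gf (k - 1) _) => G G1 G2.
move/(congr1 (fun f : fps _ => f n.+1)).
rewrite !fpsDE !fpsNE fps_constM -[fps_X]expr1 fps_XnE.
rewrite ltnS ltn0 subSS subn0 big_distrl fps_sumE => e.
(* The Euler operator multiplies this coefficient by [n + 1], whence the factor [1 / (n + 1)]. *)
have -> : egf_coef G n.+1 =
    n.+1%:R^-1 *: (fps_euler G n.+1 *+ n.+1`!).
  by rewrite /= mulrnAC -[X in _ *: X]scaler_nat scalerA mulVf ?scale1r.
rewrite e {e} mulrnBl mulrnDl -sumrMnl.
rewrite (eq_bigr _ (fun j _ => coef_bernoulli_factor (tnth a j) G n)).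
rewrite sumrN 2!scalerBr mulrnBl.
congr (_ - _ - _).
(* In the term [x t G], the [n + 1] from [(n+1)! = (n+1) n!] cancels that factor. *)
rewrite -mulrnAr factS mulnC mulrnA -[X in _ *: (_ * X)]scaler_nat.
by rewrite -scalerAr scalerA mulVf ?scale1r.
Qed.

End Recurrence.

Theorem theorem3 (R : realType) (r : nat) (k : int) (a : r.-tuple R[i])
    (hr : (0 < r)%N) (ha : forall j : 'I_r, tnth a j != 0) (n : nat) :
  S_poly k a n.+1 =
    'X * S_poly k a n
    - (n.+1%:R)^-1 *: (\sum_(j < r) \sum_(l < n.+1)
        ('C(n.+1, l)%:R * (- tnth a j) ^+ (n.+1 - l)
          * bernoulli R[i] (n.+1 - l)) *: S_poly k a l)
    - (n.+1%:R)^-1 *: (S_poly k (rcons_tuple a 1) n.+1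
                       - S_poly (k - 1) (rcons_tuple a 1) n.+1).
Proof. by apply: S_poly_recurrence => // m; rewrite Num.Theory.pnatr_eq0. Qed.
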